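(* Let $f:\mathbb R^n\to\mathbb R\cup\{+\infty\}$ be proper and lower semicontinuous, and for every $\bar x\in\operatorname{dom} f$ let $f_{\bar x}$ be a local model function for $f$ around $\bar x$. Assume: (a) $f$ is bounded from below; (b) for every $\bar x\in\operatorname{dom} f$, $f_{\bar x}$ is bounded from below by an affine function; (c) $H:\mathbb R^n\to\mathbb R^{n\times n}_{\ge\mu}$ is continuous; (d) $x^*\in\mathbb R^n$ is an accumulation point of the sequence $(x^k)_{k\in\mathbb N}$ generated by the Model Proximal Quasi-Newton Method; (e) for all $\bar x\in\operatorname{dom} f$ the function $g_{\bar x}:=f_{\bar x}-f$ is smooth, and there is a constant $L>0$ such that for all $\bar x\in\operatorname{dom} f$ and all $x$, $\partial g_{\bar x}(x)\subset L\,B_{\|x-\bar x\|}(0)$ (that is, $\|\nabla g_{\bar x}(x)\|\le L\|x-\bar x\|$); (f) $f$ has the KL property at $x^*$. Then the whole sequence $(x^k)_{k\in\mathbb N}$ converges to $x^*$, and $x^*$ is a stationary point of $f$, i.e. $0\in\partial f(x^* )$.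
   Context: **Subdifferentials.** For $h:\mathbb R^n\to\mathbb R\cup\{+\infty\}$ and $\bar x\in\operatorname{dom}h=\{x: h(x)<\infty\}$, the regular subdifferential $\hat\partial h(\bar x)$ is the set of $v$ with $\liminf_{x\to\bar x,\,x\ne\bar x}\frac{h(x)-h(\bar x)-\langle v,x-\bar x\rangle}{\|x-\bar x\|}\ge 0$. The (limiting) subdifferential $\partial h(\bar x)$ is the set of $v$ for which there are $x^k\to\bar x$ with $h(x^k)\to h(\bar x)$ and $v^k\in\hat\partial h(x^k)$ with $v^k\to v$. Both are empty for $\bar x\notin\operatorname{dom}h$. A point $x\in\operatorname{dom}h$ is stationary for $h$ if $0\in\partial h(x)$. **KL property.** A proper lower semicontinuous $g:\mathbb R^n\to\mathbb R\cup\{+\infty\}$ has the KL (Kurdyka-Łojasiewicz) property at $x^*\in\operatorname{dom}\partial g$ (i.e. $\partial g(x^* )\neq\emptyset$) if there exist $\eta>0$, a neighborhood $U$ of $x^*$ and a continuous concave function $\varphi:[0,\eta]\to\mathbb R_+$ with $\varphi(0)=0$, $\varphi\in C^1(0,\eta)$, $\varphi'(t)>0$ for all $t\in(0,\eta)$, such that $\varphi'(g(x)-g(x^* ))\,\operatorname{dist}(0,\partial g(x))\ge1$ for all $x\in U$ with $g(x^* )<g(x)<g(x^* )+\eta$. **Model functions.** A growth function is a differentiable $\omega:\mathbb R_+\to\mathbb R_+$ with $\omega(0)=\omega'_+(0)=0$ (right derivative). A local model function for $f$ around $\bar x\in\operatorname{dom}f$ is a proper lower semicontinuous $f_{\bar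 x}:\mathbb R^n\to\mathbb R\cup\{+\infty\}$ with $\operatorname{dom}f_{\bar x}=\operatorname{dom}f$ for which there is a growth function $\omega_{\bar x}$ (depending on $\bar x$) with $|f(x)-f_{\bar x}(x)|\le\omega_{\bar x}(\|x-\bar x\|)$ for all $x\in\operatorname{dom} f$ in some neighborhood of $\bar x$. The function $g_{\bar x}$ is regarded as a real-valued function on $\mathbb R^n$ that equals $f_{\bar x}-f$ on $\operatorname{dom}f$, so that $f_{\bar x}=g_{\bar x}+f$; ''smooth'' means continuously differentiable on $\mathbb R^n$. **Notation.** $B_r(z)$ is the closed ball of radius $r\geq 0$ centered at $z$. $\mathbb R^{n\times n}_{\ge\mu}$ is the set of symmetric $n\times n$ matrices with smallest eigenvalue $\ge\mu$. For positive definite $A$, $\|v\|_A=\sqrt{\langle Av,v\rangle}$. **Model Proximal Quasi-Newton Method.** Parameters: $\tau>1$, $\mu>0$, $0<\gamma_{\min}\le\gamma_{\max}<\infty$, $\delta\in(0,\tfrac12)$, $H:\mathbb R^n\to\mathbb R^{n\times n}_{\ge\mu}$ continuous. Start with $x^0\in\operatorname{dom}f$. For $k=0,1,2,\dots$, as long as $x^k$ is not a stationary point of $f$: choose $\gamma_k^0\in[\gamma_{\min},\gamma_{\max}]$ and set $H_k:=H(x^k)$; for $i=0,1,2,\dots$ put $\gamma_{k,i}:=\tau^{i+1}\gamma_k^0$ and compute a (global) solution $x^{k,i}$ of $\min_x f_{x^k}(x)+\frac{\gamma_{k,i}}2\|x-x^k\|_{H_k}^2$, until $|f(x^{k,i})-f_{x^k}(x^{k,i})|\le\delta\frac{\gamma_{k,i}}2\|x^{k,i}-x^k\|_{H_k}^2$;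 with $i_k$ the terminal value of $i$, set $\gamma_k:=\gamma_{k,i_k}$ and $x^{k+1}:=x^{k,i_k}$. The generated sequence $(x^k)_{k\in\mathbb N}$ is understood to be infinite. *)

(* Defs.v *)
From HB Require Import structures.
From mathcomp Require Import all_boot all_order all_algebra.
From mathcomp Require Import all_classical all_reals all_analysis.

Set Implicit Arguments.
Unset Strict Implicit.
Unset Printing Implicit Defensive.

Import Order.TTheory GRing.Theory Num.Theory.
Import numFieldNormedType.Exports.

Local Open Scope classical_set_scope.
Local Open Scope ring_scope.

(* R^n is 'rV[R]_n with its library topology. The library norm `|x| on 'rV[R]_n
   is the sup norm, so the Euclidean norm is introduced separately. *)

Definition dot (R : realType) (n : nat) (u v : 'rV[R]_n) : R :=
  \sum_(i < n) u 0 i * v 0 i.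

Definition enorm (R : realType) (n : nat) (v : 'rV[R]_n) : R :=
  Num.sqrt (dot v v).

Definition ecball (R : realType) (n : nat) (r : R) (z : 'rV[R]_n) :
    set 'rV[R]_n :=
  [set y | enorm (y - z) <= r].

(* v *m A^T is the row vector representing the column vector A v. *)
Definition mnorm (R : realType) (n : nat) (A : 'M[R]_n) (v : 'rV[R]_n) : R :=
  Num.sqrt (dot (v *m A^T) v).

Definition sym_eig_ge (R : realType) (n : nat) (mu : R) : set 'M[R]_n :=
  [set A | A^T = A /\ forall a : R, eigenvalue A a -> mu <= a].

Definition edom (R : realType) (n : nat) (h : 'rV[R]_n -> \bar R) :
    set 'rV[R]_n :=
  [set x | (h x < +oo)%E].

Definition proper_fun (R : realType) (n : nat) (h : 'rV[R]_n -> \bar R) : Prop :=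
  (forall x, h x != -oo%E) /\ exists x, edom h x.

Definition regular_subdiff (R : realType) (n : nat) (h : 'rV[R]_n -> \bar R)
    (xb : 'rV[R]_n) : set 'rV[R]_n :=
  [set v | edom h xb /\
    (0 <= limf_einf
      (fun x => (h x - h xb - (dot v (x - xb))%:E) * ((enorm (x - xb))^-1)%:E)
      xb^')%E].

Definition subdiff (R : realType) (n : nat) (h : 'rV[R]_n -> \bar R)
    (xb : 'rV[R]_n) : set 'rV[R]_n :=
  [set v | edom h xb /\
    exists (x : nat -> 'rV[R]_n) (w : nat -> 'rV[R]_n),
      [/\ x @ \oo --> xb,
          h (x k) @[k --> \oo] --> h xb,
          forall k, regular_subdiff h (x k) (w k) &
          w @ \oo --> v]].

Definition stationary (R : realType) (n : nat) (h : 'rV[R]_n -> \bar R)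
    (x : 'rV[R]_n) : Prop :=
  edom h x /\ subdiff h x 0.

(* Equal to +oo when S is empty. *)
Definition dist_set (R : realType) (n : nat) (z : 'rV[R]_n) (S : set 'rV[R]_n) :
    \bar R :=
  ereal_inf [set (enorm (z - v))%:E | v in S].

Definition concave_on (R : realType) (D : set R) (phi : R -> R) : Prop :=
  forall s t l : R, D s -> D t -> 0 <= l <= 1 ->
    l * phi s + (1 - l) * phi t <= phi (l * s + (1 - l) * t).

(* phi : [0, eta] -> R_+ is represented by a total function of which only the
   restriction to [0, eta] is constrained. *)
Definition desingularizing (R : realType) (eta : R) (phi : R -> R) : Prop :=
  [/\ {within `[0, eta], continuous phi},
      concave_on `[0, eta] phi,
      (forall t : R, t \in `[0, eta] -> 0 <= phi t),
      phi 0 = 0 &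
      forall t : R, t \in `]0, eta[ ->
        [/\ derivable phi t 1, {for t, continuous (derive1 phi)} & 0 < derive1 phi t]].

Definition KL_property (R : realType) (n : nat) (g : 'rV[R]_n -> \bar R)
    (xs : 'rV[R]_n) : Prop :=
  [/\ proper_fun g, lower_semicontinuous g, subdiff g xs !=set0 &
   exists (eta : R) (U : set 'rV[R]_n) (phi : R -> R),
     [/\ 0 < eta, nbhs xs U, desingularizing eta phi &
      forall x, U x -> (g xs < g x)%E -> (g x < g xs + eta%:E)%E ->
        (1 <= (derive1 phi (fine (g x - g xs)))%:E * dist_set 0 (subdiff g x))%E]].

(* Differentiability on R_+ is two-sided on ]0, +oo[ and one-sided at 0. *)
Definition growth_function (R : realType) (w : R -> R) : Prop :=
  [/\ (forall t : R, 0 <= t -> 0 <= w t),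
      (forall t : R, 0 < t -> derivable w t 1),
      w 0 = 0 &
      (w t - w 0) / t @[t --> 0^'+] --> (0 : R)].

Definition local_model (R : realType) (n : nat) (f : 'rV[R]_n -> \bar R)
    (xb : 'rV[R]_n) (m : 'rV[R]_n -> \bar R) : Prop :=
  [/\ proper_fun m, lower_semicontinuous m, edom m = edom f &
   exists2 w : R -> R, growth_function w &
     \forall x \near xb, edom f x ->
       (`|f x - m x| <= (w (enorm (x - xb)))%:E)%E].

Definition bounded_below (R : realType) (n : nat) (h : 'rV[R]_n -> \bar R) :
    Prop :=
  exists c : R, forall x, (c%:E <= h x)%E.

Definition affinely_minorized (R : realType) (n : nat)
    (h : 'rV[R]_n -> \bar R) : Prop :=
  exists (a : 'rV[R]_n) (b : R), forall x, ((dot a x + b)%:E <= h x)%E.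

Definition gradient (R : realType) (n : nat) (g : 'rV[R]_n -> R)
    (x : 'rV[R]_n) : 'rV[R]_n :=
  \row_(i < n) 'd g x (delta_mx 0 i).

Definition smooth (R : realType) (n : nat) (g : 'rV[R]_n -> R) : Prop :=
  (forall x : 'rV[R]_n, differentiable g x) /\ continuous (gradient g).

Definition global_min (R : realType) (n : nat) (h : 'rV[R]_n -> \bar R)
    (z : 'rV[R]_n) : Prop :=
  forall y, (h z <= h y)%E.

Definition subproblem (R : realType) (n : nat) (m : 'rV[R]_n -> \bar R)
    (A : 'M[R]_n) (gam : R) (xk : 'rV[R]_n) (y : 'rV[R]_n) : \bar R :=
  (m y + (gam / 2 * mnorm A (y - xk) ^+ 2)%:E)%E.

Definition acceptable (R : realType) (n : nat) (f m : 'rV[R]_n -> \bar R)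
    (A : 'M[R]_n) (delta gam : R) (xk : 'rV[R]_n) (y : 'rV[R]_n) : Prop :=
  (`|f y - m y| <= (delta * (gam / 2) * mnorm A (y - xk) ^+ 2)%:E)%E.

(* One outer iteration from xk to xk1: g0 is the initial stepsize, y i the
   i-th trial point and ik the terminal inner index. *)
Definition mpqn_step (R : realType) (n : nat) (f : 'rV[R]_n -> \bar R)
    (F : 'rV[R]_n -> 'rV[R]_n -> \bar R) (H : 'rV[R]_n -> 'M[R]_n)
    (tau gmin gmax delta : R) (xk xk1 : 'rV[R]_n) : Prop :=
  exists (g0 : R) (y : nat -> 'rV[R]_n) (ik : nat),
    let gam := fun i : nat => tau ^+ i.+1 * g0 in
    [/\ gmin <= g0 <= gmax,
        (forall i, (i <= ik)%N ->
          global_min (subproblem (F xk) (H xk) (gam i) xk) (y i)),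
        (forall i, (i < ik)%N ->
          ~ acceptable f (F xk) (H xk) delta (gam i) xk (y i)),
        acceptable f (F xk) (H xk) delta (gam ik) xk (y ik) &
        xk1 = y ik].

(* The infinite sequences generated by the method: as it stops at a stationary
   point, no iterate of an infinite run is stationary. *)
Definition mpqn_sequence (R : realType) (n : nat) (f : 'rV[R]_n -> \bar R)
    (F : 'rV[R]_n -> 'rV[R]_n -> \bar R) (H : 'rV[R]_n -> 'M[R]_n)
    (tau gmin gmax delta : R) (x : nat -> 'rV[R]_n) : Prop :=
  edom f (x 0%N) /\
  forall k, ~ stationary f (x k) /\
    mpqn_step f F H tau gmin gmax delta (x k) (x k.+1).

(* Main.v *)
Require Import Defs.
From HB Require Import structures.
From mathcomp Require Import all_boot all_order all_algebra.
From mathcomp Require Import all_classical all_reals all_analysis.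
From mathcomp Require Import ring lra.


Import Order.TTheory GRing.Theory Num.Theory.
Import numFieldNormedType.Exports.

Local Open Scope classical_set_scope.
Local Open Scope ring_scope.

(* The gradient bound gives [|g u z| <= L |z - u|^2], which makes the inner loop
   stop at stepsizes bounded uniformly in [k]. Minimality and the acceptance test
   then yield sufficient decrease [f (x (k+1)) + a |x (k+1) - x k|^2 <= f (x k)],
   and Fermat's rule a subgradient of [f] at [x (k+1)] of norm at most
   [B |x (k+1) - x k|] as long as [x k] stays in a ball around [xs] on which [H]
   is bounded. Comparing the subproblem values at [x (k+1)] and at [xs] shows that
   [f (x k)] tends to [f xs]. With the KL inequality this bounds a Lyapunov
   function of the iterates that dominates [|x k - xs|], is eventually
   nonincreasing, and is small infinitely often. *)

(** * Euclidean geometry of row vectors, and its comparison with the library sup norm *)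

Section Euclidean.
Context {R : realType} {n : nat}.
Implicit Types (u v w : 'rV[R]_n) (A : 'M[R]_n).

Lemma dotC u v : dot u v = dot v u.
Proof. by apply: eq_bigr => i _; rewrite mulrC. Qed.

Lemma dotDl u v w : dot (u + v) w = dot u w + dot v w.
Proof. by rewrite -big_split; apply: eq_bigr => i _; rewrite mxE mulrDl. Qed.

Lemma dotZl a u v : dot (a *: u) v = a * dot u v.
Proof. by rewrite [RHS]mulr_sumr; apply: eq_bigr => i _; rewrite mxE mulrA. Qed.

Lemma dotNl u v : dot (- u) v = - dot u v.
Proof. by rewrite -scaleN1r dotZl mulN1r. Qed.

Lemma dotBl u v w : dot (u - v) w = dot u w - dot v w.
Proof. by rewrite dotDl dotNl. Qed.

Lemma dotDr u v w : dot w (u + v) = dot w u + dot w v.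
Proof. by rewrite dotC dotDl !(dotC w). Qed.

Lemma dotZr a u v : dot u (a *: v) = a * dot u v.
Proof. by rewrite dotC dotZl dotC. Qed.

Lemma dotNr u v : dot u (- v) = - dot u v.
Proof. by rewrite dotC dotNl dotC. Qed.

Lemma dotBr u v w : dot w (u - v) = dot w u - dot w v.
Proof. by rewrite dotDr dotNr. Qed.

Lemma dot0l u : dot 0 u = 0.
Proof. by rewrite -(scale0r 0) dotZl mul0r. Qed.

Lemma dotv_ge0 u : 0 <= dot u u.
Proof. by apply: sumr_ge0 => i _; rewrite -expr2 sqr_ge0. Qed.

Lemma enorm_ge0 u : 0 <= enorm u.
Proof. exact: sqrtr_ge0. Qed.

Lemma sqr_enorm u : enorm u ^+ 2 = dot u u.
Proof. by rewrite sqr_sqrtr// dotv_ge0. Qed.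

Lemma enormN u : enorm (- u) = enorm u.
Proof. by rewrite /enorm dotNl dotNr opprK. Qed.

Lemma enormC u v : enorm (u - v) = enorm (v - u).
Proof. by rewrite -enormN opprB. Qed.

Lemma enormZ a u : enorm (a *: u) = `|a| * enorm u.
Proof.
by rewrite /enorm dotZl dotZr mulrA -expr2 sqrtrM ?sqr_ge0// sqrtr_sqr.
Qed.

Lemma enorm0 : enorm (0 : 'rV[R]_n) = 0.
Proof. by rewrite -(scale0r 0) enormZ normr0 mul0r. Qed.

Lemma ler_entry_enorm u i : `|u 0 i| <= enorm u.
Proof.
rewrite -(ler_pXn2r (n:=2)) ?nnegrE ?enorm_ge0// sqr_enorm real_normK ?num_real//.
rewrite /dot (bigD1 i)//= -expr2 lerDl.
by apply: sumr_ge0 => j _; rewrite -expr2 sqr_ge0.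
Qed.

Lemma enorm_eq0 u : enorm u = 0 -> u = 0.
Proof.
move=> u0; apply/rowP => i; rewrite mxE; apply/eqP.
by rewrite -normr_le0 -u0 ler_entry_enorm.
Qed.

Lemma enorm_gt0 u : u != 0 -> 0 < enorm u.
Proof.
move=> u0; rewrite lt_neqAle enorm_ge0 andbT eq_sym.
by apply: contra u0 => /eqP/enorm_eq0 ->.
Qed.

(** Cauchy-Schwarz: the squared norm of [dot v v *: u - dot u v *: v] equals [dot v v] times the
    Gram determinant of [u] and [v]. *)
Lemma dot_le_enorm u v : `|dot u v| <= enorm u * enorm v.
Proof.
have [->|v0] := eqVneq v 0; first by rewrite dotC dot0l normr0 enorm0 mulr0.
have vv0 : 0 < dot v v by rewrite -sqr_enorm exprn_gt0// enorm_gt0.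
rewrite -(ler_pXn2r (n:=2)) ?nnegrE ?mulr_ge0 ?enorm_ge0//.
rewrite exprMn !sqr_enorm real_normK ?num_real//.
have := dotv_ge0 (dot v v *: u - dot u v *: v).
rewrite !(dotBl, dotBr, dotZl, dotZr) (dotC v u) => h.
have : 0 <= dot v v * (dot u u * dot v v - dot u v ^+ 2) by lra.
by rewrite pmulr_rge0// subr_ge0.
Qed.

Lemma enormD u v : enorm (u + v) <= enorm u + enorm v.
Proof.
rewrite -(ler_pXn2r (n:=2)) ?nnegrE ?addr_ge0 ?enorm_ge0//.
rewrite sqrrD !sqr_enorm !(dotDl, dotDr) (dotC v u).
have := le_trans (ler_norm _) (dot_le_enorm u v); lra.
Qed.

Lemma enorm_triangle u v w : enorm (u - w) <= enorm (u - v) + enorm (v - w).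
Proof. by rewrite (le_trans _ (enormD _ _))// addrA subrK. Qed.

Lemma enorm_le_sum u : enorm u <= \sum_i `|u 0 i|.
Proof.
have ed i : enorm (delta_mx 0 i : 'rV[R]_n) = 1.
  rewrite /enorm /dot (bigD1 i)//= !mxE !eqxx mulr1 big1 ?addr0 ?sqrtr1// => j ji.
  by rewrite !mxE (negbTE ji) andbF mulr0.
rewrite {1}(row_sum_delta u); apply: (big_ind2 (fun v b => enorm v <= b)).
- by rewrite enorm0.
- by move=> v b w c vb wc; rewrite (le_trans (enormD _ _))// lerD.
- by move=> i _; rewrite enormZ ed mulr1.
Qed.

Lemma ler_entry_mxnorm (p q : nat) (B : 'M[R]_(p, q)) i j : `|B i j| <= `|B|.
Proof.
rewrite [leRHS]/Num.norm/= mx_normrE.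
by apply/bigmax_geP; right => /=; exists (i, j).
Qed.

Lemma ler_mxnorm_enorm u : `|u| <= enorm u.
Proof.
rewrite [leLHS]/Num.norm/= mx_normrE; apply/bigmax_leP; split => [|[i j] _/=].
  exact: enorm_ge0.
by rewrite (ord1 i) ler_entry_enorm.
Qed.

Lemma ler_enorm_mxnorm u : enorm u <= n%:R * `|u|.
Proof.
apply: (le_trans (enorm_le_sum u)).
rewrite mulr_natl -[X in _ *+ X]card_ord -sumr_const.
by apply: ler_sum => i _; exact: ler_entry_mxnorm.
Qed.

(** A crude bound: each of the [n] entries of the product is a sum of [n] terms of size at most
    [|A| * enorm u]. Only some bound proportional to [|A|] matters later. *)
Lemma enorm_mulmx_tr u A : enorm (u *m A^T) <= n%:R ^+ 2 * `|A| * enorm u.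
Proof.
apply: (le_trans (enorm_le_sum _)).
rewrite expr2 -!mulrA mulr_natl -[X in _ *+ X]card_ord -sumr_const.
apply: ler_sum => i _; rewrite mxE (le_trans (ler_norm_sum _ _ _))//.
rewrite mulr_natl -[X in _ *+ X]card_ord -sumr_const.
apply: ler_sum => j _; rewrite normrM mulrC !mxE.
by rewrite ler_pM ?ler_entry_enorm ?ler_entry_mxnorm.
Qed.

Lemma near_enorm u e : 0 < e -> \forall v \near u, enorm (v - u) < e.
Proof.
move=> e0; have d0 : 0 < e / (n%:R + 1) by rewrite divr_gt0// ltr_wpDl.
near=> v.
have h : `|u - v| < e / (n%:R + 1) by near: v; exact: cvgr_dist_lt.
rewrite enormC (le_lt_trans (ler_enorm_mxnorm _))//.
have n1 : 0 < n%:R + 1 :> R by rewrite ltr_wpDl.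
rewrite (@le_lt_trans _ _ ((n%:R + 1) * `|u - v|)) ?ler_wpM2r ?lerDl//.
by move: h; rewrite ltr_pdivlMr// mulrC.
Unshelve. all: by end_near. Qed.

Lemma nbhs_enorm u (U : set 'rV[R]_n) : nbhs u U ->
  exists2 r, 0 < r & forall v, enorm (v - u) < r -> U v.
Proof.
move=> /nbhs_ballP[r/= r0 rU]; exists r => // v vr; apply: rU.
rewrite -ball_normE/= (le_lt_trans (ler_mxnorm_enorm _))//.
by rewrite enormC.
Qed.

Lemma cvg_enorm (x : nat -> 'rV[R]_n) u :
  (forall e, 0 < e -> \forall k \near \oo, enorm (x k - u) < e) -> x @ \oo --> u.
Proof.
move=> xu; apply/cvgrPdist_lt => e e0; near=> k.
rewrite (le_lt_trans (ler_mxnorm_enorm _))// enormC.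
by near: k; exact: xu.
Unshelve. all: by end_near. Qed.

End Euclidean.

(** * Quadratic forms of symmetric matrices with spectrum bounded below *)

Section QuadraticForm.
Context {R : realType} {n : nat}.
Implicit Types (u v w : 'rV[R]_n) (A : 'M[R]_n).

Lemma dotE u v : dot u v = (u *m v^T) 0 0.
Proof. by rewrite mxE; apply: eq_bigr => i _; rewrite mxE. Qed.

Lemma dot_mulmx_sym A u v :
  A^T = A -> dot (u *m A^T) v = dot (v *m A^T) u.
Proof. by move=> As; rewrite [RHS]dotC !dotE trmx_mul trmxK As mulmxA. Qed.

Lemma continuous_dot (a b : 'rV[R]_n -> 'rV[R]_n) :
  continuous a -> continuous b -> continuous (fun u => dot (a u) (b u)).
Proof.
move=> ca cb; rewrite /dot.
have addc : continuous (fun x : R * R => x.1 + x.2) by exact: add_continuous.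
apply: (@continuous_big R 'I_n +%R 0 xpredT addc) => i _ u.
have coordc (c : 'rV[R]_n -> 'rV[R]_n) :
    continuous c -> {for u, continuous (fun w => c w 0 i)}.
  move=> cc; apply: (@continuous_comp _ _ _ c (fun w : 'rV[R]_n => w 0 i)).
    exact: cc.
  exact: coord_continuous.
by apply: (@cvgM _ _ (nbhs u)); exact: coordc.
Qed.

Lemma continuous_mulmxr A : continuous (fun u => u *m A).
Proof.
move=> u; apply/(@cvgrPdist_le _ _ _ (nbhs u)) => e e0.
have N0 : 0 < n%:R ^+ 2 * `|A^T| + 1 by rewrite ltr_wpDl// mulr_ge0.
near=> v.
rewrite -mulmxBl (le_trans (ler_mxnorm_enorm _))// -[in leLHS](trmxK A).
rewrite (le_trans (enorm_mulmx_tr _ _))//.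
apply: (@le_trans _ _ ((n%:R ^+ 2 * `|A^T| + 1) * enorm (u - v))).
  by rewrite ler_wpM2r ?enorm_ge0// lerDl.
rewrite mulrC -ler_pdivlMr// enormC ltW//.
by near: v; apply: near_enorm; rewrite divr_gt0.
Unshelve. all: by end_near. Qed.

(** At [t = - b / (a + 1)] the quadratic equals [- (b / (a + 1)) ^+ 2 * (a + 2)]. Dividing by
    [a + 1] rather than [a] covers the case [a = 0]. *)
Lemma linear_coef_eq0 (a b : R) :
  0 <= a -> (forall t, 0 <= 2 * t * b + t ^+ 2 * a) -> b = 0.
Proof.
move=> a0 /(_ (- b / (a + 1))).
have a1 : a + 1 != 0 by rewrite gt_eqF// ltr_wpDl.
have -> : 2 * (- b / (a + 1)) * b + (- b / (a + 1)) ^+ 2 * a =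
  - (b / (a + 1)) ^+ 2 * (a + 2) by field.
rewrite mulNr oppr_ge0 => h; apply/eqP.
have : (b / (a + 1)) ^+ 2 <= 0.
  by rewrite -(pmulr_lle0 (x := a + 2)) // ltr_wpDl.
by rewrite le_eqVlt ltNge sqr_ge0 orbF sqrf_eq0 mulf_eq0 invr_eq0 (negbTE a1) orbF.
Qed.

(* A minimizer of the Rayleigh quotient on the unit sphere is an eigenvector:
   the positive form [A - m] vanishes there, hence so does its gradient. *)
Lemma rayleigh_ge (mu : R) A v :
  sym_eig_ge mu A -> mu * dot v v <= dot (v *m A^T) v.
Proof.
move=> [As Aeig].
have [->|v0] := eqVneq v 0; first by rewrite mul0mx !dot0l mulr0.
pose S := [set u : 'rV[R]_n | dot u u = 1].
have normalized u : u != 0 -> S ((enorm u)^-1 *: u).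
  move=> /enorm_gt0 u0; rewrite /S/= dotZl dotZr -sqr_enorm; field.
  by rewrite gt_eqF.
have cid : continuous (@id 'rV[R]_n) by move=> u; exact: cvg_id.
have cS : compact S.
  apply: bounded_closed_compact.
    exists 1; split; first exact: num_real.
    move=> M M1 u Su; apply: (le_trans (ler_mxnorm_enorm u)); rewrite /enorm.
    by rewrite Su sqrtr1 ltW.
  apply: (@preimage_closed _ _ (fun u => dot u u) [set 1]) => //.
    by move=> u _; apply: continuous_dot.
have cq : {within S, continuous (fun u : 'rV[R]_n => dot (u *m A^T) u)}.
  by apply: continuous_subspaceT; apply: continuous_dot => //;
    exact: continuous_mulmxr.
have S0 : S !=set0 by exists ((enorm v)^-1 *: v); exact: normalized.
have [c + cmin] := EVT_min_rV S0 cS cq.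
rewrite inE => Sc; set m := dot (c *m A^T) c in cmin.
have qm u : m * dot u u <= dot (u *m A^T) u.
  have [->|u0] := eqVneq u 0; first by rewrite mul0mx !dot0l mulr0.
  have := cmin ((enorm u)^-1 *: u); rewrite inE => /(_ (normalized _ u0)).
  rewrite -scalemxAl dotZl dotZr mulrA -expr2 exprVn -sqr_enorm mulrC.
  by rewrite ler_pdivlMr// exprn_gt0// enorm_gt0.
have mev : eigenvalue A m.
  apply/eigenvalueP; exists c; last first.
    apply/eqP => c0; move: Sc; rewrite /S/= c0 dot0l => /eqP.
    by rewrite eq_sym oner_eq0.
  apply/eqP; rewrite -subr_eq0 -{1}As; apply/eqP/enorm_eq0/eqP.
  have [w Ew] : exists w, w = c *m A^T - m *: c by eexists.
  rewrite -Ew -(sqrf_eq0 (enorm w)) sqr_enorm.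
  (* Along [c + t *: w] the nonnegative form [A - m], which vanishes at [c], has linear coefficient
     [2 * dot w w], by symmetry of [A]. *)
  apply/eqP/(@linear_coef_eq0 (dot (w *m A^T) w - m * dot w w)).
    by rewrite subr_ge0.
  move=> t; have := qm (c + t *: w).
  rewrite mulmxDl -scalemxAl !(dotDl, dotDr, dotZl, dotZr).
  rewrite (dot_mulmx_sym _ w c As) (dotC w c).
  have -> : dot w w = dot (c *m A^T) w - m * dot c w.
    by rewrite {1}Ew dotBl dotZl.
  rewrite -/m; move: Sc; rewrite /S/= => ->; lra.
by apply: le_trans (qm v); rewrite ler_wpM2r ?dotv_ge0// Aeig.
Qed.

(** [Num.sqrt] is 0 on negative numbers, so squaring undoes it only because the Rayleigh bound makes
    the form nonnegative. *)
Lemma sqr_mnorm (mu : R) A v :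
  0 <= mu -> sym_eig_ge mu A -> mnorm A v ^+ 2 = dot (v *m A^T) v.
Proof.
move=> mu0 Ah; rewrite sqr_sqrtr// (le_trans _ (rayleigh_ge _ _ _ Ah))//.
by rewrite mulr_ge0// dotv_ge0.
Qed.

Lemma dot_mulmx_le A v : dot (v *m A^T) v <= n%:R ^+ 2 * `|A| * enorm v ^+ 2.
Proof.
rewrite (le_trans (ler_norm _))// (le_trans (dot_le_enorm _ _))//.
by rewrite [_ ^+ 2 in leRHS]expr2 mulrA ler_wpM2r ?enorm_ge0// enorm_mulmx_tr.
Qed.

End QuadraticForm.

(** * Regular subgradients, gradients and first-order estimates *)

Section Subgradients.
Context {R : realType} {n : nat}.
Implicit Types (u v w y z : 'rV[R]_n) (h : 'rV[R]_n -> \bar R).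

(** The quotient-free form of the definition: dividing by [enorm (y - z)] bounds the difference
    quotient below by [- e] on a punctured neighborhood, and [e] is arbitrary. *)
Lemma regular_subdiff_near h z v : h z \is a fin_num ->
  (forall e, 0 < e -> \forall y \near z,
    ((fine (h z) + dot v (y - z) - e * enorm (y - z))%:E <= h y)%E) ->
  regular_subdiff h z v.
Proof.
move=> hz hle; split; first by rewrite /edom/= ltey_eq hz.
rewrite limf_einfE; apply/lee_addgt0Pr => e e0.
rewrite -leeBlDr// sub0e.
pose V := [set y | (((fine (h z) + dot v (y - z) - e * enorm (y - z))%:E <= h y)%E
  /\ y != z)].
apply: (@le_trans _ _ (ereal_inf
   [set (h y - h z - (dot v (y - z))%:E) * ((enorm (y - z))^-1)%:E | y in V]%E)).
  apply/ereal_infP => _ [y [yle yz] <-].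
  have yz0 : 0 < enorm (y - z) by rewrite enorm_gt0// subr_eq0.
  move: yle; rewrite -(fineK hz); case: (h y) => [r||]//=.
    rewrite !lee_fin => yle; rewrite ler_pdivlMr//; lra.
  move=> _; rewrite gt0_mulye ?leey// lte_fin invr_gt0//.
apply: ereal_sup_ubound; exists V => //.
have := hle _ e0; rewrite /dnbhs /within/=; apply: filterS => y yle yz.
by split.
Qed.

Lemma regular_subdiff_subdiff h z : regular_subdiff h z `<=` subdiff h z.
Proof.
move=> v [dz hv]; split => //; exists (fun=> z), (fun=> v).
by split => //; exact: cvg_cst.
Qed.

Lemma diffE_dot (p : 'rV[R]_n -> R) z v : 'd p z v = dot (gradient p z) v.
Proof.
rewrite {1}(row_sum_delta v) linear_sum; apply: eq_bigr => i _.
by rewrite linearZ/= mxE mulrC.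
Qed.

(** The library remainder is small relative to the sup norm, which the Euclidean norm dominates. *)
Lemma differentiable_enorm (p : 'rV[R]_n -> R) z : differentiable p z ->
  forall e, 0 < e -> \forall y \near z,
    `|p y - p z - dot (gradient p z) (y - z)| <= e * enorm (y - z).
Proof.
move=> /diff_locally/eqaddoP dp e e0.
rewrite (near_shift 0); have := dp e e0; apply: filterS => u/=.
rewrite subr0 addrK -diffE_dot opprD addrA => /le_trans; apply.
by rewrite ler_pM2l// ler_mxnorm_enorm.
Qed.

(** This inclusion turns a bound on all subgradients of a smooth function into a bound on its
    gradient. *)
Lemma gradient_subdiff (p : 'rV[R]_n -> R) z : differentiable p z ->
  subdiff (EFin \o p) z (gradient p z).
Proof.
move=> dp; apply/regular_subdiff_subdiff/regular_subdiff_near => // e e0.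
have := differentiable_enorm _ _ dp _ e0; apply: filterS => y.
by rewrite ler_norml lee_fin => /andP[+ _]/=; lra.
Qed.

(** Mean value theorem on the segment from [z] to [y]: at the intermediate point [z + c *: u] the
    gradient has norm at most [L * c * enorm u], and [c <= 1]. *)
Lemma quadratic_growth (p : 'rV[R]_n -> R) z L :
  (forall y, differentiable p y) ->
  (forall y, enorm (gradient p y) <= L * enorm (y - z)) ->
  forall y, `|p y - p z| <= L * enorm (y - z) ^+ 2.
Proof.
move=> dp pL y; pose u := y - z.
pose q t := p (z + t *: u).
have dq (t : R) : is_derive t (1 : R) q (dot (gradient p (z + t *: u)) u).
  have dpt : derivable p (z + t *: u) u by exact: diff_derivable.
  (* The difference quotients of [q] at [t] are those of [p] at [z + t *: u] in direction [u], so
     derivability and the derivative carry over. *)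
  have eqf : (fun s : R => s^-1 *: ((q \o shift t) (s *: 1) - q t)) =
      (fun s : R => s^-1 *: ((p \o shift (z + t *: u)) (s *: u) - p (z + t *: u))).
    apply/funext => s /=; rewrite /q /=.
    by rewrite scalerDl [_ *: 1]mulr1 addrCA.
  split; first by rewrite /derivable eqf.
  by rewrite /derive eqf -/(derive p _ u) deriveE// diffE_dot.
have cq : {within `[0, 1], continuous q}.
  by apply: derivable_within_continuous => t _; exact: ex_derive.
have [c] := MVT ltr01 (fun t _ => dq t) cq.
rewrite in_itv/= => /andP[c0 c1].
have zu : z + u = y by rewrite addrC subrK.
rewrite /q scale1r zu scale0r addr0 subr0 mulr1 => ->.
have L0 : 0 <= L * enorm (y - z) by rewrite (le_trans _ (pL y))// enorm_ge0.
rewrite (le_trans (dot_le_enorm _ _))// expr2 mulrA ler_wpM2r ?enorm_ge0//.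
rewrite (le_trans (pL _))// [z + _]addrC addrK enormZ gtr0_norm// mulrCA.
by rewrite ler_piMl// ltW.
Qed.

End Subgradients.

(** * Concave desingularizing functions and the one-step length estimate *)

Section Desingularizing.
Context {R : realType}.
Implicit Types (eta s t : R) (phi : R -> R).

(** By concavity the slope of [phi] between [s + h] and [s], for [t - s < h < 0], is at most the
    slope between [t] and [s]. Letting [h] tend to 0 from the left gives the derivative at [s]. *)
Lemma concave_tangent eta phi s t :
  concave_on `[0, eta] phi -> derivable phi s 1 ->
  0 <= t -> t <= s -> s <= eta ->
  phi t - phi s <= derive1 phi s * (t - s).
Proof.
move=> phic dphi t0; rewrite le_eqVlt => /predU1P[->|ts] seta.
  by rewrite !subrr mulr0.
rewrite -ler_ndivlMr ?subr_lt0//.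
pose Q (h : R) := h^-1 *: (phi (h + s) - phi s).
have Qcvg : Q h @[h --> 0^'] --> derive1 phi s.
  have -> : Q = (fun h : R => h^-1 *: ((phi \o shift s) (h *: 1) - phi s)).
    by apply/funext => h /=; rewrite [_ *: 1]mulr1.
  rewrite derive1E; exact: dphi.
have Qcvgl := cvg_dnbhs_at_left Qcvg.
rewrite -(cvg_lim _ Qcvgl)//; apply: limr_le; first by apply/cvg_ex; eexists; exact: Qcvgl.
near=> h.
have h0 : h < 0 by [].
have ht : t - s < h by near: h; apply: nbhs_left_gt; rewrite subr_lt0.
have ts0 : t - s < 0 by rewrite subr_lt0.
pose l := h / (t - s).
have l01 : 0 <= l <= 1.
  rewrite /l; apply/andP; split.
    by rewrite ltW// ltr_ndivlMr// mul0r.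
  by rewrite ler_ndivrMr// mul1r ltW.
have hl : h = l * (t - s) by rewrite /l divfK// lt_eqF.
have := phic t s l _ _ l01; rewrite /= !in_itv/=.
have -> : l * t + (1 - l) * s = h + s by rewrite hl; ring.
rewrite t0 (le_trans t0 (ltW ts)) seta (le_trans (ltW ts) seta) => /(_ isT isT) hc.
rewrite /Q [_ *: _]mulrC ler_ndivrMr//.
suff -> : (phi t - phi s) / (t - s) * h = l * (phi t - phi s) by lra.
by rewrite /l; ring.
Unshelve. all: by end_near. Qed.

Lemma desingularizing_small eta phi : 0 < eta -> desingularizing eta phi ->
  forall e, 0 < e -> exists2 d, 0 < d & forall t, 0 <= t -> t < d -> phi t < e.
Proof.
move=> eta0 [/(continuous_within_itvP _ eta0)[_ + _] _ _ phi0 _] e e0.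
rewrite phi0 => /cvgr_lt/(_ _ e0); rewrite /at_right near_withinE.
move=> /nbhs_ballP[d/= d0 hd]; exists d => // t.
rewrite le_eqVlt => /predU1P[<- _|t0 td]; first by rewrite phi0.
by apply: hd => //; rewrite -ball_normE/= sub0r normrN gtr0_norm.
Qed.

(* Multiplying the second bound by [B * dp] and using the first one gives
   [d^2 <= dp * (B / a * D)], and AM-GM concludes. *)
Lemma two_step_le (a B dp d p D : R) :
  0 < a -> 0 < B -> 0 <= d -> 0 <= dp ->
  1 <= p * (B * dp) -> p * (a * d ^+ 2) <= D ->
  2 * d <= dp + B / a * D.
Proof.
move=> a0 B0 d0 dp0 p1 pD.
have p0 : 0 < p.
  rewrite ltNge; apply/negP => p0; have := lt_le_trans ltr01 p1.
  by rewrite ltNge mulr_le0_ge0// mulr_ge0// ltW.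
have D0 : 0 <= D.
  by apply: le_trans pD; rewrite mulr_ge0// ?(ltW p0)// mulr_ge0 ?sqr_ge0// ltW.
have X0 : 0 <= B / a * D by rewrite mulr_ge0// divr_ge0// ltW.
have dX : d ^+ 2 <= dp * (B / a * D).
  have Bdp0 : 0 <= B * dp by rewrite mulr_ge0// ltW.
  have ad0 : 0 <= a * d ^+ 2 by rewrite mulr_ge0 ?sqr_ge0// ltW.
  have h1 := ler_wpM2l Bdp0 pD.
  have h2 := ler_wpM2l ad0 p1.
  have -> : dp * (B / a * D) = (B * dp * D) / a by rewrite mulrAC; ring.
  by rewrite ler_pdivlMr//; lra.
have d20 : 0 <= 2 * d by rewrite mulr_ge0.
have dpX0 : 0 <= dp + B / a * D by exact: addr_ge0.
rewrite -(ler_pXn2r (n:=2))//.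
have := sqr_ge0 (dp - B / a * D); move: (B / a * D) dX => X dX; lra.
Qed.

End Desingularizing.

(** * Convergence of abstract descent sequences under the KL property *)

Section KLConvergence.
Context {R : realType} {n : nat}.
Implicit Types (f : 'rV[R]_n -> \bar R) (x : nat -> 'rV[R]_n) (xs : 'rV[R]_n).

Lemma cluster_frequently x xs : cluster (x @ \oo) xs ->
  forall e, 0 < e -> forall N, exists2 k, (N <= k)%N & enorm (x k - xs) < e.
Proof.
move=> xcl e e0 N.
have [] := xcl [set y | exists2 k, (N <= k)%N & y = x k]
    [set y | enorm (y - xs) < e].
- by exists N => // k /= Nk; exists k.
- exact: near_enorm.
- by move=> _ [[k Nk ->] xe]; exists k.
Qed.

(** If some value lay below [f xs], lower semicontinuity would put a later iterate near [xs] above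
    that value, against monotonicity. Conversely one iterate close to [xs] makes the next value
    close to [f xs], and monotonicity keeps all later values there. *)
Lemma descent_values_cvg f x xs r B :
  lower_semicontinuous f -> f xs \is a fin_num ->
  (forall k, f (x k) \is a fin_num) ->
  (forall k, fine (f (x k.+1)) <= fine (f (x k))) ->
  0 < r -> 0 < B ->
  (forall k, enorm (x k - xs) < r ->
    fine (f (x k.+1)) <= fine (f xs) + B * enorm (x k - xs) ^+ 2) ->
  cluster (x @ \oo) xs ->
  (forall k, fine (f xs) <= fine (f (x k))) /\
  (forall e, 0 < e -> exists N, forall k, (N <= k)%N ->
    fine (f (x k)) - fine (f xs) < e).
Proof.
move=> flsc fxs ffin fdec r0 B0 fup xcl.
have mono j k : (j <= k)%N -> fine (f (x k)) <= fine (f (x j)).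
  elim: k => [|k IH]; first by rewrite leqn0 => /eqP ->.
  rewrite leq_eqVlt => /predU1P[->//|]; rewrite ltnS => /IH.
  exact: le_trans (fdec k).
split=> [k|e e0].
  rewrite leNgt; apply/negP => fk.
  have [|V Vxs fV] := flsc xs (fine (f (x k))).
    by rewrite -(fineK fxs) lte_fin.
  have [r' r'0 r'V] := nbhs_enorm _ _ Vxs.
  have [j kj jr] := cluster_frequently _ _ xcl _ r'0 k.
  have := fV _ (r'V _ jr); rewrite -(fineK (ffin j)) lte_fin.
  by rewrite ltNge mono.
(* With [t = enorm (x k - xs)], the bound 1 gives [B * t ^+ 2 <= B * t], and the bound [e / (B + 1)]
   then makes this less than [e]. *)
pose e1 := Num.min r (Num.min 1 (e / (B + 1))).
have e10 : 0 < e1 by rewrite /e1 !lt_min r0 ltr01 divr_gt0// addr_gt0.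
have [k _] := cluster_frequently _ _ xcl _ e10 0%N.
rewrite /e1 !lt_min => /and3P[kr k1 ke].
exists k.+1 => j kj; rewrite ltrBlDl (le_lt_trans (mono _ _ kj))//.
rewrite (le_lt_trans (fup _ kr))// ltrD2l.
move: ke; rewrite ltr_pdivlMr ?addr_gt0// => ke.
have E0 := enorm_ge0 (x k - xs).
rewrite (le_lt_trans _ ke)// mulrC expr2 -mulrA ler_wpM2l//.
rewrite (@le_trans _ _ B)// ?lerDl// mulrC ler_piMr// ?(ltW B0)// ltW//.
Qed.

(* The Lyapunov function is [V k = |x (k+1) - xs| + d k + B / a * phi (s (k+1))]
   with [d k = |x (k+1) - x k|] and [s k = f (x k) - f xs]: it does not increase
   once it is below [rho], and it is frequently small. *)
Theorem KL_descent_cvg f x xs (a B r : R) :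
  lower_semicontinuous f -> KL_property f xs ->
  cluster (x @ \oo) xs ->
  (forall k, f (x k) \is a fin_num) ->
  (forall k, ~ stationary f (x k)) ->
  0 < a -> 0 < B -> 0 < r ->
  (forall k, fine (f (x k.+1)) + a * enorm (x k.+1 - x k) ^+ 2 <= fine (f (x k))) ->
  (forall k, enorm (x k - xs) < r ->
    exists2 w, regular_subdiff f (x k.+1) w & enorm w <= B * enorm (x k.+1 - x k)) ->
  (forall k, enorm (x k - xs) < r ->
    fine (f (x k.+1)) <= fine (f xs) + B * enorm (x k - xs) ^+ 2) ->
  x @ \oo --> xs /\ stationary f xs.
Proof.
move=> flsc [[fNy _] _ [v0 [xsdom _]] [eta [U [phi [eta0 nU phiD KL]]]]] xcl ffin xns.
move=> a0 B0 r0 fdec fsub fup.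
have fxs : f xs \is a fin_num.
  by rewrite fin_numE fNy/=; move: xsdom; rewrite /edom/= => /lt_eqF ->.
pose d k := enorm (x k.+1 - x k); pose E k := enorm (x k - xs).
pose s k := fine (f (x k)) - fine (f xs).
have d_ge0 k : 0 <= d k by exact: enorm_ge0.
have [s0 scvg] : (forall k, 0 <= s k) /\
    forall e, 0 < e -> exists N, forall k, (N <= k)%N -> s k < e.
  have [|lo hi] := descent_values_cvg f x xs r B flsc fxs ffin _ r0 B0 fup xcl.
    move=> k; apply: le_trans (fdec k); rewrite lerDl mulr_ge0 ?sqr_ge0//.
    exact: ltW.
  by split=> // k; rewrite subr_ge0.
have sdec k : s k.+1 + a * d k ^+ 2 <= s k.
  by rewrite /s addrAC lerD2r; exact: fdec.
have dcvg e : 0 < e -> exists N, forall k, (N <= k)%N -> d k < e.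
  move=> e0; have [|N hN] := scvg (a * e ^+ 2).
    by rewrite mulr_gt0// exprn_gt0.
  exists N => k /hN sk; rewrite -(ltr_pXn2r (n:=2)) ?nnegrE ?(ltW e0)//.
  rewrite -(ltr_pM2l a0) (le_lt_trans _ sk)//.
  by apply: le_trans (sdec k); rewrite lerDr.
(* The KL inequality concerns only values strictly above [f xs]. If [s k = 0], descent forces
   [d k = 0], so the subgradient at [x k.+1] is zero and that iterate would be stationary. *)
have s_gt0 k : E k < r -> 0 < s k.
  move=> Er; rewrite lt_neqAle s0 andbT eq_sym; apply/eqP => sk0.
  have dk0 : d k = 0.
    apply/eqP; have := sdec k; rewrite sk0 => h.
    have : a * d k ^+ 2 <= 0 by have := s0 k.+1; lra.
    by rewrite pmulr_rle0// le_eqVlt ltNge sqr_ge0 orbF sqrf_eq0.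
  have [w wsub wle] := fsub k Er.
  have w0 : w = 0.
    apply/enorm_eq0/eqP; rewrite eq_le enorm_ge0 andbT.
    by move: wle; rewrite -/(d k) dk0 mulr0.
  have /eqP := enorm_eq0 _ dk0; rewrite subr_eq0 => /eqP xk.
  apply: (xns k.+1); split; first by case: wsub.
  by apply: regular_subdiff_subdiff; rewrite -w0.
have [rU rU0 rUU] := nbhs_enorm _ _ nU.
(* Within [rho] of [xs] both the subgradient bound and the KL inequality are available. *)
pose rho := Num.min r rU.
have rho0 : 0 < rho by rewrite lt_min r0.
have [Neta hNeta] := scvg _ eta0.
pose V k := E k.+1 + d k + B / a * phi (s k.+1).
have [_ phic phi_ge0 _ dphi] := phiD.
have phis k : (Neta <= k)%N -> 0 <= phi (s k).
  by move=> /hNeta sk; apply: phi_ge0; rewrite in_itv/= s0 ltW.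
have ca0 : 0 <= B / a by rewrite divr_ge0// ltW.
have VE k : (Neta <= k)%N -> E k.+1 + d k <= V k.
  by move=> Nk; rewrite /V lerDl mulr_ge0// phis// leqW.
have Edk k : E k <= E k.+1 + d k.
  have := enorm_triangle (x k) (x k.+1) xs.
  by rewrite (enormC (x k) (x k.+1)) /E /d; lra.
have EdkS k : E k.+1 <= E k + d k.
  have := enorm_triangle (x k.+1) (x k) xs.
  by rewrite /E /d; lra.
(* [V k < rho] places [x k] in the ball of the subgradient bound and [x k.+1] in that of the KL
   inequality, which is applied at [x k.+1]. *)
have Vdec k : (Neta <= k)%N -> V k < rho -> V k.+1 <= V k.
  move=> Nk Vrho; have Edrho := le_lt_trans (VE k Nk) Vrho.
  have EkS : E k.+1 < rho by apply: le_lt_trans Edrho; rewrite lerDl.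
  have Ek : E k < rho by exact: le_lt_trans Edrho.
  move: EkS Ek; rewrite !lt_min => /andP[EkSr EkSU] /andP[Ekr _].
  have [w wsub wle] := fsub k Ekr.
  have sS0 := s_gt0 _ EkSr.
  have sSeta := hNeta _ (leqW Nk).
  have [|dphiS _ dphi0] := dphi (s k.+1); first by rewrite in_itv/= sS0.
  have fE : f (x k.+1) = (fine (f (x k.+1)))%:E by rewrite fineK.
  have fsE : f xs = (fine (f xs))%:E by rewrite fineK.
  have := KL _ (rUU _ EkSU).
  rewrite fE fsE !lte_fin -subr_gt0 -/(s k.+1) => /(_ sS0).
  rewrite -ltrBlDl -/(s k.+1) => /(_ sSeta)/= KLw.
  have pw : 1 <= derive1 phi (s k.+1) * (B * d k).
    rewrite -lee_fin EFinM; apply: (le_trans KLw).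
    rewrite lee_pmul2l ?lte_fin//; apply: ereal_inf_le.
    exists (enorm (0 - w))%:E; last by rewrite sub0r enormN lee_fin.
    by exists w => //; exact: regular_subdiff_subdiff.
  have pD : derive1 phi (s k.+1) * (a * d k.+1 ^+ 2) <= phi (s k.+1) - phi (s k.+2).
    have := @concave_tangent _ eta phi (s k.+1) (s k.+2) phic dphiS (s0 _).
    have sdS := sdec k.+1.
    have ad0 : 0 <= a * d k.+1 ^+ 2 by rewrite mulr_ge0 ?sqr_ge0// ltW.
    have ss : s k.+2 <= s k.+1 by apply: le_trans sdS; rewrite lerDl.
    move=> /(_ ss (ltW sSeta)) ct.
    have : derive1 phi (s k.+1) * (a * d k.+1 ^+ 2) <=
        derive1 phi (s k.+1) * (s k.+1 - s k.+2).
      by rewrite ler_pM2l//; lra.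
    lra.
  (* This bounds [2 * d k.+1]: one copy pays for [E k.+2 <= E k.+1 + d k.+1], the other is the
     middle term of [V k.+1]. *)
  have := two_step_le _ _ _ _ _ _ a0 B0 (d_ge0 _) (d_ge0 _) pw pD.
  have := EdkS k.+1; rewrite /V; lra.
have Ecvg e : 0 < e -> exists N, forall k, (N <= k)%N -> E k < e.
  move=> e0; pose e' := Num.min rho e.
  have e'0 : 0 < e' by rewrite lt_min rho0.
  have e3 : 0 < e' / 3 by rewrite divr_gt0.
  have [N1 hN1] := dcvg _ e3.
  have [dl dl0 hdl] := desingularizing_small _ _ eta0 phiD (e' / 3 / (B / a))
    (divr_gt0 e3 (divr_gt0 B0 a0)).
  have [N2 hN2] := scvg _ dl0.
  (* The close iterate is taken at a positive index [K.+1] because [V K] contains [E K.+1]. Each of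
     the three terms of [V K] is then below [e' / 3], and [e' <= rho] lets [Vdec] be iterated from
     [K] on. *)
  have [[//|K] + EK] := cluster_frequently _ _ xcl _ e3
    (Neta + N1 + N2).+1; rewrite ltnS => NK.
  have NetaK : (Neta <= K)%N by rewrite (leq_trans _ NK)// -addnA leq_addr.
  have N1K : (N1 <= K)%N by rewrite (leq_trans _ NK)// addnAC leq_addl.
  have N2K : (N2 <= K)%N by rewrite (leq_trans _ NK)// leq_addl.
  have VK : V K < e'.
    have phiK : B / a * phi (s K.+1) < e' / 3.
      rewrite mulrC -ltr_pdivlMr ?divr_gt0//; apply: hdl => //.
      by apply: hN2; rewrite leqW.
    have := hN1 _ N1K; move: EK; rewrite -/(E K.+1) /V; lra.
  have Vall j : V (K + j)%N < e'.
    elim: j => [|j IH]; first by rewrite addn0.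
    rewrite addnS; apply: le_lt_trans (IH); apply: Vdec.
      by rewrite (leq_trans NetaK)// leq_addr.
    by apply: (lt_le_trans IH); rewrite ge_min lexx.
  exists K.+1 => -[//|k]; rewrite ltnS => Kk.
  have := Vall (k - K)%N; rewrite subnKC// lt_min => /andP[_]; apply: le_lt_trans.
  apply: le_trans (VE k (leq_trans NetaK Kk)); by rewrite lerDl.
have xcvg : x @ \oo --> xs.
  by apply: cvg_enorm => e /Ecvg[N hN]; exists N.
split=> //; split=> //; split=> //.
(* The sequence is shifted by [N] so that every term has a controlled subgradient, of norm at most
   [B * d (k + N)], which tends to 0. *)
have [N hN] := Ecvg _ r0.
have hw k : exists w, regular_subdiff f (x (k + N).+1) w /\ enorm w <= B * d (k + N)%N.
  by have [|w ? ?] := fsub (k + N)%N; [apply: hN; exact: leq_addl|exists w].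
have [w wP] := choice hw.
exists (fun k => x (k + N).+1), w; split.
- apply: cvg_enorm => e /Ecvg[M hM]; exists M => // k /= Mk.
  by apply: hM; rewrite leqW// (leq_trans Mk)// leq_addr.
- rewrite -(fineK fxs); apply: cvg_EFin; first by exists 0%N => // k _; exact: ffin.
  apply/cvgrPdist_lt => e /scvg[M hM]; exists M => // k /= Mk.
  rewrite distrC -/(s (k + N).+1) ger0_norm//.
  by apply: hM; rewrite leqW// (leq_trans Mk)// leq_addr.
- by move=> k; have [] := wP k.
- apply: cvg_enorm => e e0; have [M hM] := dcvg (e / B) (divr_gt0 e0 B0).
  exists M => // k /= Mk; rewrite subr0; have [_ wle] := wP k.
  rewrite (le_lt_trans wle)// mulrC -ltr_pdivlMr//.
  by apply: hM; rewrite (leq_trans Mk)// leq_addr.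
Qed.

End KLConvergence.

(** * One iteration of the method: optimality and stepsize bounds *)

Section ModelStep.
Context {R : realType} {n : nat}.
Implicit Types (f m : 'rV[R]_n -> \bar R) (p : 'rV[R]_n -> R) (A : 'M[R]_n).
Implicit Types (u y z : 'rV[R]_n).

Lemma edom_fin_num f z : proper_fun f -> edom f z -> f z \is a fin_num.
Proof. by move=> [fNy _] fz; rewrite fin_numE fNy/= (lt_eqF fz). Qed.

(** The model estimate, read at the center itself, has right-hand side [w 0 = 0]. *)
Lemma model_diff_center f m p z : proper_fun f -> edom f z ->
  local_model f z m -> (forall y, m y = ((p y)%:E + f y)%E) -> p z = 0.
Proof.
move=> fp fz [_ _ _ [w [_ _ w0 _] /nbhs_singleton/(_ fz)]] + mE.
rewrite mE subrr enorm0 w0.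
case: (f z) (edom_fin_num _ _ fp fz) => [s _|//|//]; rewrite /= lee_fin.
by rewrite normr_le0 opprD addrCA subrr addr0 oppr_eq0 => /eqP.
Qed.

Lemma global_min_edom f m p A gam u y : edom f u ->
  (forall z, m z = ((p z)%:E + f z)%E) ->
  global_min (subproblem m A gam u) y -> edom f y.
Proof.
move=> fu mE ymin; have := ymin u; rewrite /subproblem !mE.
rewrite /edom/= in fu *; case: (f y) => [r||]//; first by rewrite ltry.
by case: (f u) fu => [||]//= r _; rewrite leye_eq.
Qed.

Lemma global_min_fine f m p A gam u y z : f y \is a fin_num ->
  f z \is a fin_num -> (forall z, m z = ((p z)%:E + f z)%E) ->
  global_min (subproblem m A gam u) y ->
  p y + fine (f y) + gam / 2 * mnorm A (y - u) ^+ 2 <=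
  p z + fine (f z) + gam / 2 * mnorm A (z - u) ^+ 2.
Proof.
move=> fy fz mE /(_ z); rewrite /subproblem !mE -(fineK fy) -(fineK fz).
by rewrite -!EFinD lee_fin.
Qed.

Lemma acceptableE f m p A delta gam u y : f y \is a fin_num ->
  (forall z, m z = ((p z)%:E + f z)%E) ->
  acceptable f m A delta gam u y <->
  `|p y| <= delta * (gam / 2) * mnorm A (y - u) ^+ 2.
Proof.
move=> fy mE; rewrite /acceptable mE.
case: (f y) fy => [s _|//|//]; rewrite /= lee_fin.
by rewrite opprD addrCA subrr addr0 normrN.
Qed.

(** Fermat's rule, obtained by expanding the minimality inequality around [y]: the remainder of [p]
    and the quadratic term in [z - y] each cost at most [e / 2 * enorm (z - y)]. *)
Lemma regular_subdiff_global_min f m p A (mu gam : R) u y : 0 <= mu -> 0 < gam ->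
  sym_eig_ge mu A -> differentiable p y -> proper_fun f -> edom f y ->
  (forall z, m z = ((p z)%:E + f z)%E) ->
  global_min (subproblem m A gam u) y ->
  regular_subdiff f y (- gradient p y - gam *: ((y - u) *m A^T)).
Proof.
move=> mu0 gam0 Amu dp fp fy mE ymin; have fyE := edom_fin_num _ _ fp fy.
apply: regular_subdiff_near => // e e0.
(* [M] bounds the quadratic form of [A]; the added 1 keeps it positive, so that it can serve as a
   divisor. *)
pose M := n%:R ^+ 2 * `|A| + 1.
have M0 : 0 < M by rewrite ltr_wpDl// mulr_ge0.
near=> z.
have [fz|fz] := eqVneq (f z) +oo%E; first by rewrite fz leey.
have fzE : f z \is a fin_num by apply: edom_fin_num => //; rewrite /edom/= ltey.
rewrite -(fineK fzE) lee_fin.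
have := global_min_fine _ _ _ _ _ _ _ _ fyE fzE mE ymin.
rewrite !(sqr_mnorm _ _ _ mu0 Amu).
have -> : z - u = (y - u) + (z - y) by rewrite [RHS]addrC addrA subrK.
have dpz : `|p z - p y - dot (gradient p y) (z - y)| <= e / 2 * enorm (z - y).
  by near: z; apply: differentiable_enorm => //; rewrite divr_gt0.
have zy : enorm (z - y) < e / (gam * M).
  by near: z; apply: near_enorm; rewrite divr_gt0// mulr_gt0.
have qzy : gam / 2 * dot ((z - y) *m A^T) (z - y) <= e / 2 * enorm (z - y).
  rewrite (@le_trans _ _ (gam / 2 * (M * enorm (z - y) ^+ 2)))//.
    rewrite ler_pM2l ?divr_gt0// (le_trans (dot_mulmx_le _ _))//.
    by rewrite ler_wpM2r ?sqr_ge0// lerDl.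
  rewrite expr2 mulrA mulrA ler_wpM2r ?enorm_ge0//.
  by move: zy; rewrite ltr_pdivlMr ?mulr_gt0//; lra.
move: dpz qzy; rewrite ler_norml => /andP[_].
move: (z - y) (y - u) => s t.
rewrite mulmxDl !(dotDl, dotDr, dotNl, dotZl).
rewrite (dot_mulmx_sym A s t) ?(proj1 Amu)//; lra.
Unshelve. all: by end_near. Qed.

(** Either the first trial is accepted, with stepsize at most [tau * gmax], or the accepted stepsize
    is [tau] times a rejected one. A stepsize above [2 * L / (delta * mu)] cannot be rejected, since
    [L * enorm (z - u) ^+ 2] then lies below the acceptance threshold. *)
Lemma mpqn_step_bound f (F : 'rV[R]_n -> 'rV[R]_n -> \bar R) H p
    (tau gmin gmax delta mu L : R) u y :
  1 < tau -> 0 < gmin -> 0 < delta -> 0 < mu -> 0 < L ->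
  proper_fun f -> edom f u -> sym_eig_ge mu (H u) ->
  (forall z, F u z = ((p z)%:E + f z)%E) ->
  (forall z, `|p z| <= L * enorm (z - u) ^+ 2) ->
  mpqn_step f F H tau gmin gmax delta u y ->
  exists gam, [/\ gmin <= gam, gam <= tau * (gmax + 2 * L / (delta * mu)),
    global_min (subproblem (F u) (H u) gam u) y &
    acceptable f (F u) (H u) delta gam u y].
Proof.
move=> tau1 gmin0 delta0 mu0 L0 fp fu Hmu FE pL [g0 [t [ik [/andP[g0min g0max] tmin tacc]]]].
move=> tik ->; exists (tau ^+ ik.+1 * g0).
have tau0 : 0 < tau by exact: lt_trans tau1.
have g00 : 0 < g0 by exact: lt_le_trans g0min.
have K0 : 0 < 2 * L / (delta * mu) by rewrite divr_gt0// mulr_gt0.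
split => //; last exact: tmin.
  rewrite (le_trans g0min)// ler_peMl ?(ltW g00)// exprn_ege1// ltW//.
case: ik tmin tacc {tik} => [|i] tmin tacc.
  rewrite expr1 ler_pM2l// (le_trans g0max)// lerDl ltW//.
rewrite exprS -mulrA ler_pM2l//; set gi := tau ^+ i.+1 * g0.
have gi0 : 0 < gi by rewrite mulr_gt0// exprn_gt0.
rewrite (@le_trans _ _ (2 * L / (delta * mu)))//; last first.
  by rewrite lerDr (le_trans _ g0max)// ltW.
rewrite leNgt; apply/negP => gilt; apply: (tacc i (ltnSn i)).
have ti := global_min_edom _ _ _ _ _ _ _ fu FE (tmin i (leqnSn i)).
apply/(acceptableE _ _ _ _ _ _ _ _ (edom_fin_num _ _ fp ti) FE).
rewrite (le_trans (pL _))// (sqr_mnorm _ _ _ (ltW mu0) Hmu).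
have := rayleigh_ge _ _ (t i - u) Hmu; rewrite -sqr_enorm => ray.
have c0 : 0 < delta * (gi / 2) by rewrite mulr_gt0// divr_gt0.
rewrite -(ler_pM2l c0) in ray; rewrite (le_trans _ ray)// [leRHS]mulrA.
rewrite ler_wpM2r ?sqr_ge0//.
by move: gilt; rewrite ltr_pdivrMr ?mulr_gt0//; lra.
Qed.

End ModelStep.

(** * Application to the generated sequence *)

Theorem theorem4p11 (R : realType) (n : nat)
    (f : 'rV[R]_n -> \bar R) (F : 'rV[R]_n -> 'rV[R]_n -> \bar R)
    (g : 'rV[R]_n -> 'rV[R]_n -> R) (H : 'rV[R]_n -> 'M[R]_n)
    (tau mu gmin gmax delta L : R)
    (x : nat -> 'rV[R]_n) (xs : 'rV[R]_n)
    (f_proper : proper_fun f) (f_lsc : lower_semicontinuous f)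
    (F_model : forall xb, edom f xb -> local_model f xb (F xb))
    (tau_gt1 : 1 < tau) (mu_gt0 : 0 < mu)
    (gmin_gt0 : 0 < gmin) (gmin_le_gmax : gmin <= gmax)
    (delta_gt0 : 0 < delta) (delta_lt : delta < 1 / 2)
    (f_bounded : bounded_below f)
    (F_minorized : forall xb, edom f xb -> affinely_minorized (F xb))
    (H_sym : forall z, sym_eig_ge mu (H z)) (H_cont : continuous H)
    (x_mpqn : mpqn_sequence f F H tau gmin gmax delta x)
    (xs_acc : cluster (x @ \oo) xs)
    (F_split : forall xb, edom f xb -> forall z, F xb z = ((g xb z)%:E + f z)%E)
    (g_smooth : forall xb, edom f xb -> smooth (g xb))
    (L_gt0 : 0 < L)
    (g_subdiff : forall xb, edom f xb -> forall z,
      subdiff (fun y => (g xb y)%:E) z `<=`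
        [set L *: v | v in ecball (enorm (z - xb)) 0])
    (f_KL : KL_property f xs) :
  x @ \oo --> xs /\ stationary f xs.
Proof.
have [x0 xstep] := x_mpqn.
have p0 u : edom f u -> g u u = 0.
  by move=> fu; exact: (model_diff_center _ _ _ _ f_proper fu (F_model u fu) (F_split u fu)).
have gradL u : edom f u -> forall z, enorm (gradient (g u) z) <= L * enorm (z - u).
  move=> fu z; have [dg _] := g_smooth u fu.
  have [v vz <-] := g_subdiff u fu z _ (gradient_subdiff _ _ (dg z)).
  rewrite enormZ gtr0_norm// ler_pM2l//.
  by move: vz; rewrite /ecball/= subr0.
have gL u : edom f u -> forall z, `|g u z| <= L * enorm (z - u) ^+ 2.
  move=> fu z; have [dg _] := g_smooth u fu.
  by have := quadratic_growth _ _ _ dg (gradL u fu) z; rewrite p0// subr0.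
pose G := tau * (gmax + 2 * L / (delta * mu)).
have step u y : edom f u -> mpqn_step f F H tau gmin gmax delta u y ->
    exists gam, [/\ gmin <= gam, gam <= G,
      global_min (subproblem (F u) (H u) gam u) y &
      acceptable f (F u) (H u) delta gam u y].
  by move=> fu; apply: (mpqn_step_bound _ _ _ _ _ _ _ _ _ _ _ _ tau_gt1 gmin_gt0
    delta_gt0 mu_gt0 L_gt0 f_proper fu (H_sym u) (F_split u fu) (gL u fu)).
have xdom k : edom f (x k).
  elim: k => // k fk; have [gam [_ _ gmn _]] := step _ _ fk (xstep k).2.
  exact: (global_min_edom _ _ _ _ _ _ _ fk (F_split _ fk) gmn).
have xfin k := edom_fin_num _ _ f_proper (xdom k).
have [r r0 Hr] := nbhs_enorm _ _ (cvgr_norm_lt _ (H_cont xs) _ (ltr_pwDr ltr01 (lexx `|H xs|))).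
(* [L] accounts for the gradient of the model difference, the other summand for the proximal term,
   with [G] bounding the stepsizes and [|H xs| + 1] bounding [H] on the ball of radius [r]. *)
pose B := L + G * (n%:R ^+ 2 * (`|H xs| + 1)).
have G0 : 0 < G.
  have gmax0 : 0 < gmax by exact: lt_le_trans gmin_le_gmax.
  have tau0 : 0 < tau by exact: lt_trans tau_gt1.
  by rewrite mulr_gt0// addr_gt0// divr_gt0 ?mulr_gt0.
have B0 : 0 < B.
  by rewrite ltr_pwDl// mulr_ge0 ?(ltW G0)// mulr_ge0 ?sqr_ge0// addr_ge0.
have HB k : enorm (x k - xs) < r -> n%:R ^+ 2 * `|H (x k)| <= n%:R ^+ 2 * (`|H xs| + 1).
  by move=> /Hr/ltW; apply: ler_wpM2l; rewrite sqr_ge0.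
(* The acceptance test gives up a fraction [delta] of the proximal term; the rest is bounded below
   through [gmin] and the Rayleigh bound [mu]. *)
pose a := (1 - delta) * (gmin / 2) * mu.
have a0 : 0 < a by rewrite !mulr_gt0//; lra.
have xsdom : edom f xs by case: f_KL => _ _ [v []].
apply: (@KL_descent_cvg R n f x xs a B r) => //.
- by move=> k; have [] := xstep k.
- move=> k; have [gam [gam_ge gam_le gmn acc]] := step _ _ (xdom k) (xstep k).2.
  have := global_min_fine _ _ _ _ _ _ _ _ (xfin k.+1) (xfin k) (F_split _ (xdom k)) gmn.
  move/(acceptableE _ _ _ _ _ _ _ _ (xfin k.+1) (F_split _ (xdom k))): acc.
  rewrite p0// !(sqr_mnorm _ _ _ (ltW mu_gt0) (H_sym _)) subrr mul0mx dot0l.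
  rewrite ler_norml => /andP[pge _] fle.
  have := rayleigh_ge _ _ (x k.+1 - x k) (H_sym (x k)); rewrite -sqr_enorm.
  set Q := dot _ _ in pge fle *; set e := enorm _ => ray.
  have : a * e ^+ 2 <= (1 - delta) * (gam / 2) * Q.
    rewrite /a -mulrA; apply: ler_pM => //.
    + by rewrite mulr_ge0 ?divr_ge0//; lra.
    + by rewrite mulr_ge0 ?sqr_ge0// ltW.
    + by rewrite ler_pM2l; lra.
  lra.
- move=> k kr; have [gam [gam_ge gam_le gmn acc]] := step _ _ (xdom k) (xstep k).2.
  have [dg _] := g_smooth _ (xdom k).
  have gam0 : 0 < gam by exact: lt_le_trans gam_ge.
  eexists.
    exact: (regular_subdiff_global_min _ _ _ _ _ _ _ _ (ltW mu_gt0) gam0 (H_sym _)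
      (dg _) f_proper (xdom k.+1) (F_split _ (xdom k)) gmn).
  rewrite (le_trans (enormD _ _))// !enormN mulrDl lerD ?gradL//.
  rewrite enormZ gtr0_norm// -[leRHS]mulrA ler_pM ?enorm_ge0 ?(ltW gam0)//.
  rewrite (le_trans (enorm_mulmx_tr _ _))// ler_wpM2r ?enorm_ge0//.
  exact: HB.
(* Minimality is compared with the competitor [xs]. Since [delta < 1], the model error at [x k.+1]
   is absorbed by the proximal term there; the error and the proximal term at [xs] together make up
   the constant [B]. *)
- move=> k kr; have [gam [gam_ge gam_le gmn acc]] := step _ _ (xdom k) (xstep k).2.
  have fxs := edom_fin_num _ _ f_proper xsdom.
  have := global_min_fine _ _ _ _ _ _ _ _ (xfin k.+1) fxs (F_split _ (xdom k)) gmn.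
  move/(acceptableE _ _ _ _ _ _ _ _ (xfin k.+1) (F_split _ (xdom k))): acc.
  rewrite ler_norml => /andP[pge _].
  have gam0 : 0 < gam by exact: lt_le_trans gam_ge.
  have : delta * (gam / 2) * mnorm (H (x k)) (x k.+1 - x k) ^+ 2 <=
      gam / 2 * mnorm (H (x k)) (x k.+1 - x k) ^+ 2.
    rewrite ler_wpM2r ?sqr_ge0// ler_piMl ?divr_ge0 ?(ltW gam0)//; lra.
  have /ler_normlP[_] := gL _ (xdom k) xs.
  rewrite [mnorm _ (xs - _) ^+ 2](sqr_mnorm _ _ _ (ltW mu_gt0) (H_sym _)).
  rewrite (enormC (x k)).
  have : gam / 2 * dot ((xs - x k) *m (H (x k))^T) (xs - x k) <=
      G * (n%:R ^+ 2 * (`|H xs| + 1)) * enorm (xs - x k) ^+ 2.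
    rewrite -[leRHS]mulrA ler_pM ?divr_ge0 ?(ltW gam0)//.
    + by rewrite (le_trans _ (rayleigh_ge _ _ _ (H_sym _)))// mulr_ge0 ?dotv_ge0// ltW.
    + lra.
    + by rewrite (le_trans (dot_mulmx_le _ _))// ler_wpM2r ?sqr_ge0// HB.
  rewrite /B; lra.
Qed.
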